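(* Let $m\ge 2$ be an integer. A pure quaternion $c$ is in the Mandelbrot set $\mathcal{M}_{\mathrm{Im}\mathbb{H}}^{m}$ if and only if $\|Q_{m,c}^{(n)}(0)\|\le 2^{1/(m-1)}$ for all $n\in\mathbb{N}$.
   Context: $\mathrm{Im}\,\mathbb{H}=\{ai+bj+ck : a,b,c\in\mathbb{R}\}$ is the set of pure quaternions, with Euclidean norm $\|ai+bj+ck\|=\sqrt{a^2+b^2+c^2}$. Unique spherical representation: every $q\in\mathrm{Im}\,\mathbb{H}$ is written $q=\rho(i\sin\phi\cos\theta+j\sin\phi\sin\theta+k\cos\phi)$ with $\rho=\|q\|\ge 0$, $0\le\theta<2\pi$, $0\le\phi\le\pi$; the triple $(\rho,\theta,\phi)$ is made unique by the conventions: for $q=0$ take $\theta=\phi=0$; for $q=ck$ with $c>0$ take $(c,0,0)$; for $q=ck$ with $c<0$ take $(|c|,0,\pi)$. Spherical power: $sp_m(q):=\rho^m\left(i\sin(m\phi)\cos(m\theta)+j\sin(m\phi)\sin(m\theta)+k\cos(m\phi)\right)$, where $(\rho,\theta,\phi)$ is the unique spherical representation of $q$. For $c\in\mathrm{Im}\,\mathbb{H}$ let $Q_{m,c}(q)=sp_m(q)+c$ for $q\in\mathrm{Im}\,\mathbb{H}$, and let $Q_{m,c}^{(n)}$ be its $n$-fold composition. Define $\mathcal{M}_{\mathrm{Im}\mathbb{H}}^{m}:=\{c\in\mathrm{Im}\,\mathbb{H} : \{Q_{m,c}^{(n)}(0)\}_{n\in\mathbb{N}}\text{ is bounded}\}$.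 *)

(* Defs.v *)
From mathcomp Require Import all_boot all_order all_algebra.
From mathcomp Require Import all_classical all_reals all_analysis.
From mathcomp Require Import ring lra.

Set Implicit Arguments.
Unset Strict Implicit.
Unset Printing Implicit Defensive.

Import Order.TTheory GRing.Theory Num.Theory.
Local Open Scope classical_set_scope.
Local Open Scope ring_scope.

(* [ImQuat a b c] is the pure quaternion a i + b j + c k. *)
Record imquat (R : realType) := ImQuat { icoef : R ; jcoef : R ; kcoef : R }.

Definition imq0 {R : realType} : imquat R := ImQuat 0 0 0.

Definition imq_add (R : realType) (p q : imquat R) : imquat R :=
  ImQuat (icoef p + icoef q) (jcoef p + jcoef q) (kcoef p + kcoef q).

Definition imq_norm (R : realType) (q : imquat R) : R :=
  Num.sqrt (icoef q ^+ 2 + jcoef q ^+ 2 + kcoef q ^+ 2).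

(* theta is the azimuth in the (i, j)-plane, phi the angle from the k-axis. *)
Definition imq_polar (R : realType) (rho theta phi : R) : imquat R :=
  ImQuat (rho * (sin phi * cos theta)) (rho * (sin phi * sin theta))
         (rho * cos phi).

(* The last three conditions fix the angles where they are not determined,
   i.e. on the k-axis. *)
Definition spherical_rep (R : realType) (q : imquat R) (t : R * R * R) : Prop :=
  let: (rho, theta, phi) := t in
  [/\ [/\ rho = imq_norm q, 0 <= theta < 2 * pi, 0 <= phi <= pi
        & q = imq_polar rho theta phi],
      q = imq0 -> theta = 0 /\ phi = 0,
      forall c : R, 0 < c -> q = ImQuat 0 0 c ->
        (rho, theta, phi) = (c, 0, 0)
    & forall c : R, c < 0 -> q = ImQuat 0 0 c ->
        (rho, theta, phi) = (`|c|, 0, pi)].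

(* The default value is irrelevant, see [sphericalP] and [spherical_rep_uniq]. *)
Definition spherical (R : realType) (q : imquat R) : R * R * R :=
  xget (0, 0, 0) [set t | spherical_rep q t].

Definition sp (R : realType) (m : nat) (q : imquat R) : imquat R :=
  let: (rho, theta, phi) := spherical q in
  imq_polar (rho ^+ m) (m%:R * theta) (m%:R * phi).

Definition Qmap (R : realType) (m : nat) (c q : imquat R) : imquat R :=
  imq_add (sp m q) c.

Definition mandelbrot (R : realType) (m : nat) : set (imquat R) :=
  [set c | exists M : R, forall n : nat, imq_norm (iter n (Qmap m c) imq0) <= M].

Lemma angle_uniq (R : realType) (t u : R) :
  0 <= t < 2 * pi -> 0 <= u < 2 * pi ->
  cos t = cos u -> sin t = sin u -> t = u.
Proof.
wlog ut : t u / u <= t => [hw|].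
  case: (leP u t) => [ut|/ltW tu] ht hu hc hs; first exact: hw.
  by apply/esym; apply: hw.
move=> ht hu hc hs.
have cd : cos (t - u) = 1 by rewrite cosB hc hs -!expr2 cos2Dsin2.
have p0 := pi_gt0 R.
have [dp|dp] := leP (t - u) pi.
  suff : t - u = 0 by lra.
  apply: cos_inj; rewrite ?in_itv/= ?cd ?cos0 //; lra.
suff : 2 * pi - (t - u) = 0 by lra.
apply: cos_inj; rewrite ?in_itv/=; [lra|lra|].
by rewrite cosB mulr_natl cos2pi sin2pi cd cos0 mul0r mulr1 addr0.
Qed.

Lemma sqr_le1_norm (R : realType) (x : R) : x ^+ 2 <= 1 -> `|x| <= 1.
Proof. by move=> x1; rewrite ler_norml; apply/andP; split; nra. Qed.

Lemma angle_exists (R : realType) (x y : R) : x ^+ 2 + y ^+ 2 = 1 ->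
  exists t : R, [/\ 0 <= t < 2 * pi, cos t = x & sin t = y].
Proof.
move=> xy1.
have x1 : -1 <= x <= 1 by rewrite -ler_norml; apply: (@sqr_le1_norm R); have := sqr_ge0 y; lra.
have p0 := pi_gt0 R.
have a0 := acos_ge0 x1; have api := acos_lepi x1.
have ca : cos (acos x) = x by apply: acosK; rewrite in_itv.
have sa : sin (acos x) = `|y|.
  by rewrite sin_acos// -sqrtr_sqr; congr Num.sqrt; lra.
have [y0|y0] := leP 0 y.
  exists (acos x); split => //; [lra|by rewrite sa ger0_norm].
exists (2 * pi - acos x).
rewrite cosB sinB mulr_natl cos2pi sin2pi ca sa ltr0_norm//.
split; [|lra|lra].
suff : acos x != 0 by move=> /eqP; lra.
by apply/eqP => h; move: sa; rewrite h sin0 ltr0_norm//; lra.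
Qed.

Lemma spherical_rep_exists (R : realType) (q : imquat R) :
  exists t, spherical_rep q t.
Proof.
have p0 := pi_gt0 R.
case: q => a b c.
have [/andP[/eqP -> /eqP ->]|ab] := boolP ((a == 0) && (b == 0)).
  have nE : imq_norm (ImQuat 0 0 c) = `|c|.
    by rewrite /imq_norm /= expr0n /= !add0r sqrtr_sqr.
  case: (ltrgtP c 0) => c0.
  - exists (`|c|, 0, pi); split.
    + split; [by rewrite nE|lra|lra|].
      by rewrite /imq_polar sinpi cospi !mul0r !mulr0 ltr0_norm// mulrN1 opprK.
    + by case; lra.
    + by move=> d d0 [] ?; exfalso; lra.
    + by move=> d d0 [] ->.
  - exists (c, 0, 0); split.
    + split; [by rewrite nE gtr0_norm|lra|lra|].
      by rewrite /imq_polar sin0 cos0 !mul0r !mulr0 mulr1.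
    + by case; lra.
    + by move=> d d0 [] ->.
    + by move=> d d0 [] ?; exfalso; lra.
  - exists (0, 0, 0); split.
    + split; [by rewrite nE c0 normr0|lra|lra|].
      by rewrite /imq_polar !mul0r c0.
    + by [].
    + by move=> d d0 [] ?; exfalso; lra.
    + by move=> d d0 [] ?; exfalso; lra.
have s0 : 0 < a ^+ 2 + b ^+ 2.
  rewrite lt_neqAle addr_ge0 ?sqr_ge0// andbT eq_sym paddr_eq0 ?sqr_ge0//.
  by rewrite !sqrf_eq0.
set rho := imq_norm (ImQuat a b c).
have r2 : rho ^+ 2 = a ^+ 2 + b ^+ 2 + c ^+ 2.
  by rewrite sqr_sqrtr//=; have := sqr_ge0 c; lra.
have r0 : 0 < rho.
  by rewrite sqrtr_gt0 /=; have := sqr_ge0 c; lra.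
set s := Num.sqrt (a ^+ 2 + b ^+ 2).
have s2 : s ^+ 2 = a ^+ 2 + b ^+ 2 by rewrite sqr_sqrtr// ltW.
have sp0 : 0 < s by rewrite sqrtr_gt0.
have rn0 : rho != 0 by rewrite gt_eqF.
have sn0 : s != 0 by rewrite gt_eqF.
have [|t [ht ct st]] := @angle_exists R (a / s) (b / s).
  by rewrite !expr_div_n -mulrDl -s2 divff// expf_neq0.
have c1 : -1 <= c / rho <= 1.
  rewrite -ler_norml; apply: sqr_le1_norm; rewrite expr_div_n ler_pdivrMr ?exprn_gt0//.
  by rewrite r2; lra.
have cp : cos (acos (c / rho)) = c / rho by apply: acosK; rewrite in_itv.
have sip : sin (acos (c / rho)) = s / rho.
  rewrite sin_acos// -[RHS]ger0_norm ?divr_ge0 ?ltW// -sqrtr_sqr.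
  congr Num.sqrt; rewrite !expr_div_n s2 -[1](@divff _ (rho ^+ 2)) ?expf_neq0//.
  by rewrite -mulrBl r2; congr (_ / _); lra.
have nab d : ImQuat a b c <> ImQuat 0 0 d.
  by case => a0 b0; move: ab; rewrite a0 b0 eqxx.
exists (rho, t, acos (c / rho)); split.
- split=> //; first by rewrite acos_ge0 ?acos_lepi.
  rewrite /imq_polar cp sip ct st.
  by congr ImQuat; field; rewrite ?rn0 ?sn0.
- by move/nab.
- by move=> d _ /nab.
- by move=> d _ /nab.
Qed.

Lemma spherical_rep_uniq (R : realType) (q : imquat R) (t u : R * R * R) :
  spherical_rep q t -> spherical_rep q u -> t = u.
Proof.
have p0 := pi_gt0 R.
case: q t u => a b c [[r t] p] [[r' t'] p'].
move=> [[rE ht hp qE] z1 P1 N1] [[rE' ht' hp' qE'] z2 P2 N2].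
have [/andP[/eqP a0 /eqP b0]|ab] := boolP ((a == 0) && (b == 0)).
  subst a b.
  case: (ltrgtP c 0) => c0.
  - by rewrite (N1 _ c0 erefl) (N2 _ c0 erefl).
  - by rewrite (P1 _ c0 erefl) (P2 _ c0 erefl).
  - move: (z1) (z2); rewrite c0 => /(_ erefl)[-> ->] /(_ erefl)[-> ->].
    by rewrite rE rE'.
move: rE'; rewrite -rE => rE'; subst r'; clear z1 P1 N1 z2 P2 N2.
case: qE => aE bE cE; case: qE' => aE' bE' cE'.
have rn0 : r != 0.
  by apply: contra ab => /eqP r0; rewrite aE bE r0 !mul0r eqxx.
have pE : p = p'.
  apply: cos_inj; rewrite ?in_itv//=.
  by apply: (mulfI rn0); rewrite -cE.
subst p'.
have sn0 : sin p != 0.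
  by apply: contra ab => /eqP s0; rewrite aE bE s0 !mul0r !mulr0 eqxx.
rewrite (@angle_uniq R t t')//; apply: (mulfI sn0); apply: (mulfI rn0).
- by rewrite -aE.
- by rewrite -bE.
Qed.

Lemma sphericalP (R : realType) (q : imquat R) :
  spherical_rep q (spherical q).
Proof. exact: (xgetPex _ (spherical_rep_exists q)). Qed.

(* Main.v *)
(* Since ||sp_m(q)|| = ||q||^m, the norms r_n of the orbit of 0 satisfy
   r_(n+1) >= r_n^m - ||c||.  If some r_n exceeds L = 2^(1/(m-1)), then some
   r_n exceeds L and is at least ||c|| (take n = 1 if ||c|| > L).  From that
   value x on, r_(n+1) >= r_n + x (x^(m-1) - 2), and x^(m-1) > 2, so the orbit
   is unbounded. *)
Require Import Defs.
From mathcomp Require Import all_boot all_order all_algebra.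
From mathcomp Require Import all_classical all_reals all_analysis.
From mathcomp Require Import ring lra.

Set Implicit Arguments.
Unset Strict Implicit.
Unset Printing Implicit Defensive.

Import Order.TTheory GRing.Theory Num.Theory.
Local Open Scope classical_set_scope.
Local Open Scope ring_scope.

Lemma imq_norm_ge0 (R : realType) (q : imquat R) : 0 <= imq_norm q.
Proof. exact: sqrtr_ge0. Qed.

Lemma imq_norm_sqr (R : realType) (q : imquat R) :
  imq_norm q ^+ 2 = icoef q ^+ 2 + jcoef q ^+ 2 + kcoef q ^+ 2.
Proof. by rewrite sqr_sqrtr// !addr_ge0// sqr_ge0. Qed.

Lemma imq_norm0 (R : realType) : imq_norm (@imq0 R) = 0.
Proof. by rewrite /imq_norm /= !expr0n /= !addr0 sqrtr0. Qed.

(** The angles are unrestricted because [sp] uses the multiples [m%:R * theta] and [m%:R * phi],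
    which may leave the spherical ranges. *)
Lemma imq_norm_polar (R : realType) (rho theta phi : R) :
  0 <= rho -> imq_norm (imq_polar rho theta phi) = rho.
Proof.
move=> rho0; rewrite -[RHS]ger0_norm// -sqrtr_sqr /imq_norm /=.
congr Num.sqrt.
have t1 := cos2Dsin2 theta; have p1 := cos2Dsin2 phi.
transitivity (rho ^+ 2 * (cos phi ^+ 2 +
    sin phi ^+ 2 * (cos theta ^+ 2 + sin theta ^+ 2))); first by ring.
by rewrite t1 mulr1 p1 mulr1.
Qed.

Lemma imq_norm_sp (R : realType) (m : nat) (q : imquat R) :
  imq_norm (sp m q) = imq_norm q ^+ m.
Proof.
rewrite /sp; have := sphericalP q; case: (spherical q) => [[rho theta] phi].
by case=> [[-> _ _ _] _ _ _]; rewrite imq_norm_polar// exprn_ge0// imq_norm_ge0.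
Qed.

Lemma imq_normB_le_add (R : realType) (p q : imquat R) :
  imq_norm p - imq_norm q <= imq_norm (imq_add p q).
Proof.
have P0 := imq_norm_ge0 p; have Q0 := imq_norm_ge0 q.
have S0 := imq_norm_ge0 (imq_add p q).
have P2 := imq_norm_sqr p; have Q2 := imq_norm_sqr q.
have S2 := imq_norm_sqr (imq_add p q).
(* From here on the norms are nonnegative reals known only through their squares, so everything is
   polynomial. *)
move: (imq_norm p) (imq_norm q) (imq_norm (imq_add p q)) P0 Q0 S0 P2 Q2 S2.
case: p q => a b c [d e f] /= P Q S P0 Q0 S0 P2 Q2 S2.
(* Cauchy-Schwarz, from Lagrange's identity. *)
have CS : (a * d + b * e + c * f) ^+ 2 <= (P * Q) ^+ 2.
  rewrite exprMn P2 Q2 -subr_ge0.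
  rewrite (_ : _ - _ = (a * e - b * d) ^+ 2 + (a * f - c * d) ^+ 2
                     + (b * f - c * e) ^+ 2); last by ring.
  by rewrite !addr_ge0// sqr_ge0.
have dot : - (P * Q) <= a * d + b * e + c * f.
  have : `|a * d + b * e + c * f| <= P * Q.
    by rewrite -(ger0_norm (mulr_ge0 P0 Q0)) -ler_sqr ?nnegrE// !real_normK ?num_real.
  by rewrite ler_norml => /andP[].
(* If [P - Q] is positive, squares may be compared: [dot] bounds the cross term of [S ^+ 2] below by
   that of [(P - Q) ^+ 2]. *)
have [PQ|PQ] := leP (P - Q) 0; first exact: le_trans S0.
rewrite -ler_sqr ?nnegrE ?(ltW PQ)// S2 sqrrB P2 Q2.
by nra.
Qed.

Lemma imq_norm_Qmap_ge (R : realType) (m : nat) (c q : imquat R) :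
  imq_norm q ^+ m - imq_norm c <= imq_norm (Qmap m c q).
Proof. by rewrite -imq_norm_sp imq_normB_le_add. Qed.

Lemma Qmap_imq0 (R : realType) (m : nat) (c : imquat R) :
  (0 < m)%N -> Qmap m c imq0 = c.
Proof.
move=> m0; rewrite /Qmap /sp; have := sphericalP (@imq0 R).
case: (spherical _) => [[rho theta] phi] [[-> _ _ _] _ _ _].
(* Positivity of [m] excludes 0^0 = 1; the zero radius then makes the angles irrelevant. *)
rewrite imq_norm0 expr0n gtn_eqF// /imq_polar !mul0r.
by case: c => a b d; rewrite /imq_add /= !add0r.
Qed.

Lemma Qmap_escape (R : realType) (k : nat) (c q : imquat R) (n : nat) :
  imq_norm c <= imq_norm q -> 2 < imq_norm q ^+ k ->
  imq_norm q + n%:R * (imq_norm q * (imq_norm q ^+ k - 2))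
    <= imq_norm (iter n (Qmap k.+1 c) q).
Proof.
set x := imq_norm q => cx x2; have x0 : 0 <= x := imq_norm_ge0 q.
elim: n => [|n IHn]; first by rewrite mul0r addr0.
rewrite iterS; apply: le_trans (imq_norm_Qmap_ge _ _ _).
set r := imq_norm _ in IHn *.
set d := x * (x ^+ k - 2) in IHn *.
have d0 : 0 <= d by rewrite mulr_ge0// subr_ge0 ltW.
have xr : x <= r by apply: le_trans IHn; rewrite lerDl mulr_ge0.
have xrk : x ^+ k <= r ^+ k by rewrite lerXn2r// nnegrE// (le_trans x0).
apply: (@le_trans _ _ (r + d)); first by rewrite -natr1 mulrDl mul1r addrA lerD2r.
rewrite exprS /d.
(* Thus r^(k+1) - r >= x^(k+1) - x. Subtracting ||c|| <= x costs a second x, whence the 2 in [d]. *)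
have : x * (x ^+ k - 1) <= r * (r ^+ k - 1) by apply: ler_pM => //; lra.
rewrite !mulrBr; lra.
Qed.

Theorem theorem12 (R : realType) (m : nat) (hm : (2 <= m)%N) (c : imquat R) :
  mandelbrot m c <->
  forall n : nat, imq_norm (iter n (Qmap m c) imq0) <= 2 `^ (1 / (m%:R - 1)).
Proof.
split; last by move=> bnd; exists (2 `^ (1 / (m%:R - 1))).
case: m hm => [|[|k]]// _ [M bM] n.
set L := 2 `^ _.
have L0 : 0 <= L := powR_ge0 _ _.
(* Here m = k + 2, so the exponent of [L] is 1/(k+1). *)
have Lk : L ^+ k.+1 = 2.
  rewrite -powR_mulrn// -powRrM -(natr1 k.+1) addrK mul1r
    mulVf ?pnatr_eq0// powRr1//.
rewrite leNgt; apply/negP => Ln.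
have [N [LN cN]] : exists N, L < imq_norm (iter N (Qmap k.+2 c) imq0) /\
    imq_norm c <= imq_norm (iter N (Qmap k.+2 c) imq0).
  have [cL|Lc] := leP (imq_norm c) L.
    by exists n; split => //; apply: le_trans cL (ltW Ln).
  by exists 1%N; rewrite /= Qmap_imq0.
set q := iter N _ _ in LN cN.
have q2 : 2 < imq_norm q ^+ k.+1.
  by rewrite -Lk ltrXn2r// ?nnegrE ?imq_norm_ge0.
set d := imq_norm q * (imq_norm q ^+ k.+1 - 2).
have d0 : 0 < d by rewrite mulr_gt0 ?subr_gt0// (le_lt_trans L0).
(* More than M/d further steps, each gaining at least [d], exceed [M]; the absolute value covers a
   negative [M]. *)
have := Qmap_escape (Num.bound `|M / d|) cN q2.
rewrite -iterD -/d leNgt => /negP; apply.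
apply: le_lt_trans (bM _) _.
rewrite -[ltLHS]add0r ler_ltD ?imq_norm_ge0// -ltr_pdivrMr//.
exact: le_lt_trans (ler_norm _) (archi_boundP (normr_ge0 _)).
Qed.
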